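(* Let $\mathbf F$ be a finite field, $k\in\mathbb N$, and let $\mathbf B$ be an $\mathbf R$-module such that $|F|$ is invertible in $\mathbf R$. Then the lattice of (non-empty) clonoids from $\mathbf F^k$ to $\mathbf B$ is isomorphic to $\prod_{i=0}^k\mathrm{Sub}(\mathbf M_{i,k}(\mathbf F,\mathbf B))$. Moreover, for $j\le k$, the sublattice $\prod_{i=0}^j\mathrm{Sub}(\mathbf M_{i,k}(\mathbf F,\mathbf B))$ (that is, the tuples whose components with index $i>j$ are the zero submodule) corresponds under this isomorphism to the clonoids consisting of functions that are generated by their $j$-ary minors.
   Context: $\mathbb N=\{1,2,\dots\}$. Rings are unital, modules are left modules; ''$|F|$ is invertible in $\mathbf R$'' means $|F|\cdot 1_{\mathbf R}$ is a unit. $\mathbf F^k$ is the $k$-dimensional vector space over $\mathbf F$; $(F^k)^m$ is identified with $F^{m\times k}$ (arguments are rows). A module over a ring $\mathbf S$ is viewed as an algebra whose $m$-ary term operations are the maps $\sum_{i=1}^ms_ix_i$, $s_i\in S$. A clonoid from $\mathbf F^k$ to $\mathbf B$ is a set $\mathcal C$ of finitary operations $f\colon (F^k)^m\to B$ ($m\ge1$) such that: (i) if $f_1,\dots,f_n\in\mathcal C$ are $m$-ary and $g$ is an $n$-ary term operation of $\mathbf B$, then $g\circ(f_1,\dots,f_n)\in\mathcal C$; (ii) if $f\in\mathcal C$ is $m$-ary and $g_1,\dots,g_m$ are $n$-ary term operations of $\mathbf F^k$, then $f\circ(g_1,\dots,g_m)\in\mathcal C$ (equivalently, $X\mapsto f(MX)$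 is in $\mathcal C$ for every $M\in F^{m\times n}$). Clonoids are ordered by inclusion and form a lattice; clonoids are taken non-empty, so each contains the zero functions. For $1\le i\le k$, $\mathbf M_{i,k}(\mathbf F,\mathbf B)$ is the module of all functions $f\colon\{X\in F^{i\times k}\mid\mathrm{rk}(X)=i\}\to B$ over the group ring $\mathbf R[\mathrm{GL}_i(\mathbf F)]$, acting by $\big(\sum_M\alpha_MM\big)f(X)=\sum_M\alpha_Mf(MX)$. Thus its submodules are the $\mathbf R$-submodules of functions closed under $f\mapsto f(M\,\cdot)$ for all $M\in\mathrm{GL}_i(\mathbf F)$. Further, $\mathbf M_{0,k}(\mathbf F,\mathbf B)=\mathbf B$ as an $\mathbf R$-module. $\mathrm{Sub}(\mathbf M)$ is the lattice of submodules of $\mathbf M$. An $m$-ary $f\colon F^{m\times k}\to B$ is generated by its $j$-ary minors if there are finitely many matrices $M_1,\dots,M_p\in F^{m\times m}$ of rank $\le j$ and $\alpha_1,\dots,\alpha_p\in R$ with $f(X)=\sum_{t=1}^p\alpha_tf(M_tX)$ for all $X$. *)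

(* Defs.v *)
From HB Require Import structures.
From mathcomp Require Import all_boot all_order all_algebra all_fingroup.
From mathcomp Require Import boolp classical_sets functions.

Set Implicit Arguments.
Unset Strict Implicit.
Unset Printing Implicit Defensive.

Import Order.TTheory GRing.Theory.

Local Open Scope ring_scope.

Notation lat_disp := (Order.Disp tt tt).

#[local] Obligation Tactic := idtac.

(* [pzRingType] also allows the zero ring and has no built-in units. *)
Definition invertible (R : pzRingType) (x : R) : Prop :=
  exists y : R, y * x = 1 /\ x * y = 1.

Definition term_op (S : pzRingType) (V : lmodType S) (m : nat)
    (g : ('I_m -> V) -> V) : Prop :=
  exists s : 'I_m -> S, forall x, g x = \sum_(i < m) s i *: x i.

Definition gen_by_minors (F : finFieldType) (R : pzRingType) (B : lmodType R)
    (k m j : nat) (f : 'M[F]_(m, k) -> B) : Prop :=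
  exists (p : nat) (M : 'I_p -> 'M[F]_m) (a : 'I_p -> R),
    (forall t, (\rank (M t) <= j)%N) /\
    (forall X, f X = \sum_(t < p) a t *: f (M t *m X)).

Section ClonoidDef.
Variables (F : finFieldType) (k : nat) (R : pzRingType) (B : lmodType R).

(* Arities are positive: [C m] is the set of the operations of arity m.+1 in C.
   The arguments of an operation are the rows of a matrix. *)
Unset Implicit Arguments.
Record clonoid := Clonoid {
  clonoid_ops :> forall m : nat, set ('M[F]_(m.+1, k) -> B);
  clonoid_nonempty : exists m f, clonoid_ops m f;
  clonoid_codom : forall (m n : nat) (f : 'I_n.+1 -> 'M[F]_(m.+1, k) -> B)
      (g : ('I_n.+1 -> B) -> B),
    (forall i, clonoid_ops m (f i)) -> term_op g ->
    clonoid_ops m (fun X => g (fun i => f i X));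
  clonoid_dom : forall (m n : nat) (f : 'M[F]_(m.+1, k) -> B)
      (g : 'I_m.+1 -> ('I_n.+1 -> 'rV[F]_k) -> 'rV[F]_k),
    clonoid_ops m f -> (forall i, term_op (g i)) ->
    clonoid_ops n (fun X => f (\matrix_i g i (fun l => row l X)))
}.
Set Implicit Arguments.

Definition clonoid_le (C D : clonoid) : bool :=
  `[< forall m, (C m `<=` D m)%classic >].

HB.instance Definition _ := gen_eqMixin clonoid.
HB.instance Definition _ := gen_choiceMixin clonoid.

Lemma clonoid_leP (C D : clonoid) :
  reflect (forall m f, C m f -> D m f) (clonoid_le C D).
Proof. exact: asboolP. Qed.

Lemma clonoid_eq (C D : clonoid) : (forall m f, C m f <-> D m f) -> C = D.
Proof.
case: C D => [C C0 C1 C2] [D D0 D1 D2] /= CD.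
have E : C = D by apply: functional_extensionality_dep => m; apply/funext => f; apply/propext.
by case: _ / E D0 D1 D2 => *; congr Clonoid; exact: Prop_irrelevance.
Qed.

Lemma clonoid0 (C : clonoid) m : C m (fun=> 0).
Proof.
have [n [f Cf]] := clonoid_nonempty C.
have Cf' : C m (fun X => f (\matrix_i 0)).
  apply: (clonoid_dom C n m f (fun=> fun=> 0)) => // i.
  by exists (fun=> 0) => x; rewrite big1 // => l _; rewrite scale0r.
apply: (clonoid_codom C m 0 (fun=> fun X => f (\matrix_i 0)) (fun=> 0)) => //.
by exists (fun=> 0) => x; rewrite big1 // => l _; rewrite scale0r.
Qed.

Lemma clonoid_le_refl : reflexive clonoid_le.
Proof. by move=> C; apply/clonoid_leP. Qed.

Lemma clonoid_le_anti : antisymmetric clonoid_le.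
Proof.
move=> C D /andP[/clonoid_leP CD /clonoid_leP DC].
by apply: clonoid_eq => m f; split; [exact: CD|exact: DC].
Qed.

Lemma clonoid_le_trans : transitive clonoid_le.
Proof.
move=> D C E /clonoid_leP CD /clonoid_leP DE.
by apply/clonoid_leP => m f /CD /DE.
Qed.

HB.instance Definition _ := Order.Le_isPOrder.Build lat_disp clonoid
  clonoid_le_refl clonoid_le_anti clonoid_le_trans.

Section Inter.
Variable P : clonoid -> Prop.

Definition clonoid_inter_ops m : set ('M[F]_(m.+1, k) -> B) :=
  fun f => forall E, P E -> E m f.

Program Definition clonoid_inter := @Clonoid clonoid_inter_ops _ _ _.
Next Obligation. by exists 0%N, (fun=> 0) => E _; exact: clonoid0. Qed.
Next Obligation.
by move=> m n f g Cf gt E PE; apply: clonoid_codom => // i; exact: Cf.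
Qed.
Next Obligation.
by move=> m n f g Cf gt E PE; apply: (clonoid_dom E m n f g) => //; exact: Cf.
Qed.

End Inter.

Definition clonoid_meet (C D : clonoid) := clonoid_inter (fun E => E = C \/ E = D).
Definition clonoid_join (C D : clonoid) :=
  clonoid_inter (fun E => clonoid_le C E /\ clonoid_le D E).

Lemma clonoid_meetP (C D E : clonoid) :
  clonoid_le C (clonoid_meet D E) = clonoid_le C D && clonoid_le C E.
Proof.
apply/clonoid_leP/andP => [H|[/clonoid_leP CD /clonoid_leP CE] m f Cf].
  by split; apply/clonoid_leP => m f /H; apply; [left|right].
by move=> _ [|] ->; [exact: CD|exact: CE].
Qed.

Lemma clonoid_joinP (C D E : clonoid) :
  clonoid_le (clonoid_join C D) E = clonoid_le C E && clonoid_le D E.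
Proof.
apply/clonoid_leP/andP => [H|[CE DE] m f]; last exact.
by split; apply/clonoid_leP => m f Cf; apply: H => G [/clonoid_leP CG /clonoid_leP DG];
  [exact: CG|exact: DG].
Qed.

HB.instance Definition _ := Order.POrder_MeetJoin_isLattice.Build lat_disp clonoid
  clonoid_meetP clonoid_joinP.

End ClonoidDef.

Arguments clonoid F k {R} B.
Arguments clonoid_ops {F k R B} c m f.
Arguments clonoid_nonempty {F k R B} c.
Arguments clonoid_codom {F k R B} c m n f g.
Arguments clonoid_dom {F k R B} c m n f g.

(* A module presented by its additive group, its set of scalars and the action
   of the scalars: exactly the data on which its lattice of submodules depends. *)
Record actModule := ActModule {
  am_carrier :> zmodType;
  am_scalar : Type;
  am_act : am_scalar -> am_carrier -> am_carrier
}.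

Section SubmoduleDef.
Variable M : actModule.

Record submodule := Submodule {
  submodule_set :> M -> Prop;
  submodule0 : submodule_set 0;
  submoduleB : forall x y, submodule_set x -> submodule_set y ->
    submodule_set (x - y);
  submodule_act : forall (s : am_scalar M) x, submodule_set x ->
    submodule_set (am_act s x)
}.

Definition submodule_le (U V : submodule) : bool := `[< (U `<=` V)%classic >].

HB.instance Definition _ := gen_eqMixin submodule.
HB.instance Definition _ := gen_choiceMixin submodule.

Lemma submodule_leP (U V : submodule) :
  reflect (forall x, U x -> V x) (submodule_le U V).
Proof. exact: asboolP. Qed.

Lemma submodule_eq (U V : submodule) : (forall x, U x <-> V x) -> U = V.
Proof.
case: U V => [U U0 U1 U2] [V V0 V1 V2] /= UV.
have E : U = V by apply/funext => x; apply/propext.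
by case: _ / E V0 V1 V2 => *; congr Submodule; exact: Prop_irrelevance.
Qed.

Lemma submodule_le_refl : reflexive submodule_le.
Proof. by move=> U; apply/submodule_leP. Qed.

Lemma submodule_le_anti : antisymmetric submodule_le.
Proof.
move=> U V /andP[/submodule_leP UV /submodule_leP VU].
by apply: submodule_eq => x; split; [exact: UV|exact: VU].
Qed.

Lemma submodule_le_trans : transitive submodule_le.
Proof.
move=> V U W /submodule_leP UV /submodule_leP VW.
by apply/submodule_leP => x /UV /VW.
Qed.

HB.instance Definition _ := Order.Le_isPOrder.Build lat_disp submodule
  submodule_le_refl submodule_le_anti submodule_le_trans.

Section Inter.
Variable P : submodule -> Prop.

Definition submodule_inter_set : set M := fun x => forall W, P W -> W x.

Program Definition submodule_inter := @Submodule submodule_inter_set _ _ _.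
Next Obligation. by move=> W _; exact: submodule0. Qed.
Next Obligation.
by move=> x y Ux Uy W PW; apply: submoduleB; [exact: Ux|exact: Uy].
Qed.
Next Obligation. by move=> s x Ux W PW; apply: submodule_act; exact: Ux. Qed.

End Inter.

Definition submodule_meet (U V : submodule) :=
  submodule_inter (fun W => W = U \/ W = V).
Definition submodule_join (U V : submodule) :=
  submodule_inter (fun W => submodule_le U W /\ submodule_le V W).

Lemma submodule_meetP (U V W : submodule) :
  submodule_le U (submodule_meet V W) = submodule_le U V && submodule_le U W.
Proof.
apply/submodule_leP/andP => [H|[/submodule_leP UV /submodule_leP UW] x Ux].
  by split; apply/submodule_leP => x /H; apply; [left|right].
by move=> _ [|] ->; [exact: UV|exact: UW].
Qed.

Lemma submodule_joinP (U V W : submodule) :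
  submodule_le (submodule_join U V) W = submodule_le U W && submodule_le V W.
Proof.
apply/submodule_leP/andP => [H|[UW VW] x]; last exact.
by split; apply/submodule_leP => x Ux; apply: H => G [/submodule_leP UG /submodule_leP VG];
  [exact: UG|exact: VG].
Qed.

HB.instance Definition _ := Order.POrder_MeetJoin_isLattice.Build lat_disp submodule
  submodule_meetP submodule_joinP.

Definition is_zero_submodule (U : submodule) : Prop := forall x, U x <-> x = 0.

End SubmoduleDef.

Section DepProduct.
Variables (I : Type) (L : I -> latticeType lat_disp).

Definition prod_lattice : Type := forall i, L i.

Definition prod_le (x y : prod_lattice) : bool :=
  `[< forall i, (x i <= y i)%O >].

HB.instance Definition _ := gen_eqMixin prod_lattice.
HB.instance Definition _ := gen_choiceMixin prod_lattice.

Lemma prod_leP (x y : prod_lattice) :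
  reflect (forall i, (x i <= y i)%O) (prod_le x y).
Proof. exact: asboolP. Qed.

Lemma prod_le_refl : reflexive prod_le.
Proof. by move=> x; apply/prod_leP. Qed.

Lemma prod_le_anti : antisymmetric prod_le.
Proof.
move=> x y /andP[/prod_leP xy /prod_leP yx].
by apply: functional_extensionality_dep => i; apply/le_anti; rewrite xy yx.
Qed.

Lemma prod_le_trans : transitive prod_le.
Proof.
move=> y x z /prod_leP xy /prod_leP yz.
by apply/prod_leP => i; exact: le_trans (xy i) (yz i).
Qed.

HB.instance Definition _ := Order.Le_isPOrder.Build lat_disp prod_lattice
  prod_le_refl prod_le_anti prod_le_trans.

Definition prod_meet (x y : prod_lattice) : prod_lattice :=
  fun i => (x i `&` y i)%O.
Definition prod_join (x y : prod_lattice) : prod_lattice :=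
  fun i => (x i `|` y i)%O.

Lemma prod_meetP (x y z : prod_lattice) :
  prod_le x (prod_meet y z) = prod_le x y && prod_le x z.
Proof.
apply/prod_leP/andP => [H|[/prod_leP xy /prod_leP xz] i].
  by split; apply/prod_leP => i; have := H i; rewrite lexI => /andP[].
by rewrite lexI xy xz.
Qed.

Lemma prod_joinP (x y z : prod_lattice) :
  prod_le (prod_join x y) z = prod_le x z && prod_le y z.
Proof.
apply/prod_leP/andP => [H|[/prod_leP xz /prod_leP yz] i].
  by split; apply/prod_leP => i; have := H i; rewrite leUx => /andP[].
by rewrite leUx xz yz.
Qed.

HB.instance Definition _ := Order.POrder_MeetJoin_isLattice.Build lat_disp
  prod_lattice prod_meetP prod_joinP.

End DepProduct.

Section FullRankModule.
Variables (F : finFieldType) (k : nat) (R : pzRingType) (B : lmodType R).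

Definition full_rank (i : nat) : Type := {X : 'M[F]_(i, k) | \rank X == i}.

Lemma rank_GLmul i (M : {'GL_i.+1[F]}) (X : full_rank i.+1) :
  \rank ((GLval M : 'M_i.+1) *m sval X) == i.+1.
Proof.
have uM : (GLval M : 'M_i.+1) \in unitmx by case: M.
by rewrite (eqmxMfull _) ?row_full_unit //; exact: (svalP X).
Qed.

Definition GLmul i (M : {'GL_i.+1[F]}) (X : full_rank i.+1) : full_rank i.+1 :=
  exist (fun Y : 'M[F]_(i.+1, k) => \rank Y == i.+1) _ (rank_GLmul M X).

(* Elements of the group ring R[GL] are written as coefficient families. With
   the formula below M.(N.f) = f(NM _), so strictly this is a left action of the
   group ring of the opposite group; the submodules are not affected. *)
Definition group_ring_act i (a : {ffun {'GL_i.+1[F]} -> R})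
    (f : full_rank i.+1 -> B) : full_rank i.+1 -> B :=
  fun X => \sum_(M : {'GL_i.+1[F]}) a M *: f (GLmul M X).

Definition Mmod (i : nat) : actModule :=
  if i is i'.+1 then @ActModule (full_rank i'.+1 -> B) _ (@group_ring_act i')
  else @ActModule B R (@GRing.scale R B).

Definition Msub (i : nat) : latticeType lat_disp := submodule (Mmod i).

End FullRankModule.

Arguments Mmod F k {R} B i.
Arguments Msub F k {R} B i.

(* Main.v *)
Require Import Defs.
From mathcomp Require Import all_boot all_order all_algebra.
From mathcomp Require Import zify boolp functions.

Set Implicit Arguments.
Unset Strict Implicit.
Unset Printing Implicit Defensive.

Import Order.TTheory GRing.Theory.

Local Open Scope ring_scope.

#[local] Obligation Tactic := idtac.

(** Kovacs: up to the factor [q ^ N], with [q] the order of [F], the singular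
    matrices span an ideal with identity in the monoid ring of ['M[F]_n]. Thus
    some integral combination [z_n] of matrices is [q ^ N] modulo singular
    matrices and satisfies [z_n X = 0 = X z_n] for every singular [X]. It is
    found by induction on [n]: for an operation [f (y, x)], with [x] the last
    [n] arguments, let [f'] be [z_n = sum_A w_A A] applied to [f] in [x], let
    [c] be the coefficient of the identity in [z_n], and put
    [f'_b x = f' (b x, x)]. Then
      [c q^n f' (y, x) - sum_b sum_u sum_A w_A f'_b (A x + u (y - b x))]
    vanishes when the rows of [x] are dependent, because [z_n x = 0], and when
    [y = a x]: the terms with [b = a] cancel the first one, and those with
    [d = a - b <> 0] involve [A + u d] summed over [u], which only depends on
    [A] through the hyperplane [d = 0], so that [z_n] kills them.

    Modulo its minors of smaller arity, an operation [f] of arity [n] is thus a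
    multiple of [z_n f], which vanishes on the matrices of rank less than [n].
    So a clonoid is determined by its operations vanishing on dependent rows,
    which are functions on full rank matrices. Conversely, given submodules
    [U_i], the operations [f] for which [z_i] sends every [i]-ary minor of [f]
    into [U_i] form a clonoid, and [X z_i = 0] ensures that its full rank
    functions are those of the [U_i]. *)

Lemma lift0_mx_eq1 (R : pzRingType) n (A : 'M[R]_n) :
  (lift0_mx A == 1%:M) = (A == 1%:M).
Proof.
rewrite /lift0_mx scalar_mx_block.
by apply/eqP/eqP => [/eq_block_mx[] //|->].
Qed.

Lemma mul_lift0_mx_col (R : pzRingType) n k (A : 'M[R]_n)
    (y : 'rV_k) (x : 'M_(n, k)) :
  lift0_mx A *m col_mx y x = col_mx y (A *m x).
Proof. by rewrite mul_block_col mul1mx !mul0mx addr0 add0r. Qed.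

Section RowFree.
Variable F : fieldType.

Lemma row_free_leq m n (A : 'M[F]_(m, n)) : row_free A -> (m <= n)%N.
Proof. by rewrite -row_leq_rank => /leq_trans; apply; exact: rank_leq_col. Qed.

Lemma row_free_mulmxl m n p (A : 'M[F]_(m, n)) (B : 'M_(n, p)) :
  row_free (A *m B) -> row_free A.
Proof. by rewrite -!row_leq_rank => /leq_trans; apply; exact: mxrankM_maxl. Qed.

Lemma row_free_mulmxr m n (A : 'M[F]_m) (B : 'M_(m, n)) :
  row_free (A *m B) -> row_free B.
Proof. by rewrite -!row_leq_rank => /leq_trans; apply; exact: mxrankM_maxr. Qed.

Lemma row_free_tr m n (A : 'M[F]_(m, n)) : row_free A^T = row_full A.
Proof. by rewrite /row_free mxrank_tr. Qed.

Lemma row_free_lift0_mx n (A : 'M[F]_n) : row_free (lift0_mx A) = row_free A.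
Proof. by rewrite !row_free_unit !unitmxE det_ublock det1 mul1r. Qed.

Lemma nrow_free_col_mx_submx n k (y : 'rV[F]_k) (x : 'M_(n, k)) :
  row_free x -> ~~ row_free (col_mx y x) -> (y <= x)%MS.
Proof.
rewrite -!row_leq_rank -ltnNge ltnS => x_free yx_dep.
have x_sub : (x <= col_mx y x)%MS by rewrite -addsmxE addsmxSr.
have y_sub : (y <= col_mx y x)%MS by rewrite -addsmxE addsmxSl.
apply: (submx_trans y_sub).
by rewrite -(geq_leqif (mxrank_leqif_sup x_sub)) (leq_trans yx_dep).
Qed.

End RowFree.

Section Minor.
Variables (F : fieldType) (k : nat).

Definition minor (V : Type) m n (M : 'M[F]_(m, n)) (f : 'M_(m, k) -> V) :
  'M_(n, k) -> V := fun X => f (M *m X).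

Lemma minor1 (V : Type) m (f : 'M_(m, k) -> V) : minor 1%:M f = f.
Proof. by apply/funext => X; rewrite /minor mul1mx. Qed.

Lemma minorM (V : Type) m n p (M : 'M_(m, n)) (P : 'M_(n, p))
    (f : 'M_(m, k) -> V) :
  minor (M *m P) f = minor P (minor M f).
Proof. by apply/funext => X; rewrite /minor mulmxA. Qed.

Lemma minorZ (R : pzRingType) (V : lmodType R) m n (M : 'M_(m, n)) a
    (f : 'M_(m, k) -> V) :
  minor M (a *: f) = a *: minor M f.
Proof. by []. Qed.

Variable V : zmodType.

Lemma minorD m n (M : 'M_(m, n)) (f g : 'M_(m, k) -> V) :
  minor M (f + g) = minor M f + minor M g.
Proof. by []. Qed.

Definition vanishing n (f : 'M[F]_(n, k) -> V) : Prop :=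
  forall X, ~~ row_free X -> f X = 0.

Lemma vanishing_minor m n (M : 'M_(m, n)) (f : 'M_(m, k) -> V) :
  vanishing f -> ~~ row_free M -> minor M f = 0.
Proof.
move=> f0 M_dep; apply/funext => X; apply: f0.
by apply: contra M_dep; exact: row_free_mulmxl.
Qed.

Lemma vanishing_wide n (f : 'M_(n, k) -> V) :
  (k < n)%N -> vanishing f -> f = 0.
Proof.
move=> kn f0; apply/funext => X; apply: f0; apply: contraL kn => /row_free_leq.
by rewrite -leqNgt.
Qed.

End Minor.

(* An element of the integral monoid ring of ['M[F]_n]. *)
Notation mxcomb F n := ('M[F]_n -> int).

Lemma intmulfctE (T : Type) (V : zmodType) (f : T -> V) (c : int) x :
  (f *~ c) x = f x *~ c.
Proof. by case: c => m; rewrite /intmul natmulfctE. Qed.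

Section MatrixCombinations.
Variables (F : finFieldType) (n : nat).
Implicit Types (w v : mxcomb F n) (c d : int).

Definition formal_sum (T : finType) (h : T -> 'M[F]_n) (a : T -> int) :
  mxcomb F n := fun A => \sum_(t | h t == A) a t.

Definition scalar_mxcomb c : mxcomb F n := fun A => c *+ (A == 1%:M).

Definition mul_mxcomb w v : mxcomb F n :=
  formal_sum (fun p => p.1 *m p.2) (fun p => w p.1 * v p.2).

Definition mxcomb_act (V : zmodType) k w (f : 'M[F]_(n, k) -> V) :
  'M_(n, k) -> V := \sum_A minor A f *~ w A.

Definition scalar_mod_singular w c : Prop :=
  {in unitmx, w =1 scalar_mxcomb c}.

Definition left_annihilator w : Prop :=
  forall (V : zmodType) k (f : 'M[F]_(n, k) -> V), vanishing (mxcomb_act w f).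

Section Action.
Variables (V : zmodType) (k : nat).
Implicit Types f g : 'M[F]_(n, k) -> V.

Lemma mxcomb_actE w f X : mxcomb_act w f X = \sum_A f (A *m X) *~ w A.
Proof.
by rewrite /mxcomb_act fct_sumE; apply: eq_bigr => A _; rewrite intmulfctE.
Qed.

Lemma formal_sum_act (T : finType) (h : T -> 'M_n) a f X :
  mxcomb_act (formal_sum h a) f X = \sum_t f (h t *m X) *~ a t.
Proof.
rewrite mxcomb_actE [RHS](partition_big h predT) //=; apply: eq_bigr => A _.
by rewrite mulrz_sumr; apply: eq_bigr => t /eqP ->.
Qed.

Lemma scalar_mxcomb_act c f : mxcomb_act (scalar_mxcomb c) f = f *~ c.
Proof.
rewrite /mxcomb_act (bigD1 1%:M) //= minor1 /scalar_mxcomb eqxx mulr1n.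
by rewrite big1 ?addr0 // => A /negPf ->; rewrite mulr0n mulr0z.
Qed.

Lemma mul_mxcomb_act w v f :
  mxcomb_act (mul_mxcomb w v) f = mxcomb_act v (mxcomb_act w f).
Proof.
apply/funext => X; rewrite formal_sum_act mxcomb_actE.
under [RHS]eq_bigr => B _ do rewrite mxcomb_actE mulrz_suml.
rewrite [RHS]exchange_big pair_bigA; apply: eq_bigr => p _ /=.
by rewrite mulrzA mulmxA.
Qed.

Lemma mxcomb_actBl w v f :
  mxcomb_act (w - v) f = mxcomb_act w f - mxcomb_act v f.
Proof.
by rewrite /mxcomb_act -sumrB; apply: eq_bigr => A _; rewrite mulrzBr.
Qed.

Lemma mxcomb_act_singular w c f : scalar_mod_singular w c ->
  mxcomb_act w f = f *~ c + \sum_(A | A \notin unitmx) minor A f *~ w A.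
Proof.
move=> wc; rewrite /mxcomb_act (bigID [in unitmx]) /=; congr (_ + _).
rewrite -[RHS]scalar_mxcomb_act /mxcomb_act [RHS](bigID [in unitmx]) /=.
rewrite [X in _ = _ + X]big1 ?addr0 => [|A A_sing].
  by apply: eq_bigr => A /wc ->.
rewrite /scalar_mxcomb (_ : (A == 1%:M) = false) ?mulr0z //.
by apply: contraNF A_sing => /eqP ->; exact: unitmx1.
Qed.

Lemma mxcomb_act_vanishing w c f :
  scalar_mod_singular w c -> vanishing f -> mxcomb_act w f = f *~ c.
Proof.
move=> wc f0; rewrite (mxcomb_act_singular f wc) big1 ?addr0 // => A.
by rewrite -row_free_unit => /(vanishing_minor f0) ->; rewrite mul0rz.
Qed.

End Action.

Lemma mxcomb_act_indicator w A :
  mxcomb_act w (fun B => (B == A)%:R : int) 1%:M = w A.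
Proof.
rewrite mxcomb_actE (bigD1 A) //= mulmx1 eqxx intz big1 ?addr0 // => B.
by rewrite mulmx1 => /negPf ->; rewrite mul0rz.
Qed.

Lemma scalar_mod_singular1 w c : scalar_mod_singular w c -> w 1%:M = c.
Proof. by move=> ->; rewrite /scalar_mxcomb ?eqxx //; exact: unitmx1. Qed.

Lemma scalar_mod_singularM w v c d :
  scalar_mod_singular w c -> scalar_mod_singular v d ->
  scalar_mod_singular (mul_mxcomb w v) (c * d).
Proof.
move=> wc vd C C_unit; rewrite /mul_mxcomb /formal_sum /scalar_mxcomb.
have term_eq (p : 'M_n * 'M_n) :
    p.1 *m p.2 == C -> w p.1 * v p.2 = (c * d) *+ (p == (1%:M, 1%:M)).
  case: p => A B /= /eqP AB_C.
  move: C_unit; rewrite -AB_C unitmx_mul => /andP[/wc -> /vd ->].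
  by rewrite /scalar_mxcomb mulrnAl mulrnAr -mulrnA mulnC mulnb.
rewrite (eq_bigr _ term_eq); have [->|C_neq1] := eqVneq C 1%:M.
  rewrite (bigD1 (1%:M, 1%:M)) /= ?mulmx1 // eqxx big1 ?addr0 // => p.
  by move=> /andP[_ /negPf ->].
rewrite big1 // => p /eqP pC; case: eqP => // p1.
by case/eqP: C_neq1; rewrite -pC p1 mulmx1.
Qed.

End MatrixCombinations.

Section Annihilator.
Variables (F : finFieldType) (n : nat) (w : mxcomb F n).
Hypothesis w_annihil : left_annihilator w.

(* The set of all [A + u *m d] only depends on the restriction of [A] to the
   hyperplane [d = 0], so the sum over [u] factors through a projection onto
   it. *)
Lemma left_annihilator_shift (V : zmodType) k (g : 'M_(n, k) -> V)
    (d : 'rV[F]_n) X :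
  d != 0 ->
  \sum_u mxcomb_act w (fun Z : 'M_(n, k) => g (Z + u *m (d *m X))) X = 0.
Proof.
move=> d_neq0.
have /row_freeP[e de1] : row_free d by rewrite /row_free rank_rV d_neq0.
pose shifts A := \sum_(u : 'cV[F]_n) g ((A + u *m d) *m X).
have proj_sing : ~~ row_free (1%:M - e *m d).
  rewrite row_free_unit; apply/negP => /mulKmx projK.
  have proj_e : (1%:M - e *m d) *m e = 0.
    by rewrite mulmxBl mul1mx -mulmxA de1 mulmx1 subrr.
  by move/eqP: de1; rewrite -[e]projK proj_e !mulmx0 eq_sym oner_eq0.
rewrite -[RHS](w_annihil shifts proj_sing) [RHS]mxcomb_actE.
under eq_bigr => u _ do rewrite mxcomb_actE.
rewrite exchange_big; apply: eq_bigr => A _ /=.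
rewrite -mulrz_suml; congr (_ *~ _).
rewrite [LHS](reindex_inj (addIr (- (A *m e)))) /=.
apply: eq_bigr => u _; rewrite /= [_ *m (d *m X)]mulmxA -mulmxDl.
by rewrite mulmxBl mulmxBr mulmx1 mulmxA [in RHS]addrAC addrA.
Qed.

Variable c : int.
Hypothesis w_scalar : scalar_mod_singular w c.
Hypothesis c_neq0 : c != 0.

(* [w] and its transpose are a left and a right annihilator, so their product is
   [c] times either of them. *)
Lemma left_annihilator_act_trmx (g : 'M[F]_n -> int) :
  mxcomb_act w (g \o trmx) 1%:M = mxcomb_act w g 1%:M.
Proof.
pose act_tr (h : 'M[F]_n -> int) A : int := mxcomb_act w h A^T.
have act_twice h : mxcomb_act w (act_tr h) 1%:M = mxcomb_act w h 1%:M * c.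
  have act_tr0 : vanishing (act_tr h).
    move=> X; rewrite row_free_unit -row_full_unit -row_free_tr.
    exact: w_annihil.
  rewrite (mxcomb_act_vanishing w_scalar act_tr0) intmulfctE mulrzz.
  by rewrite /act_tr trmx1.
apply: (mulIf c_neq0); rewrite -!act_twice !mxcomb_actE.
under eq_bigr => B _ do rewrite mulmx1 /act_tr mxcomb_actE mulrz_suml.
under [RHS]eq_bigr => B _ do rewrite mulmx1 /act_tr mxcomb_actE mulrz_suml.
rewrite exchange_big; apply: eq_bigr => B _; apply: eq_bigr => C _ /=.
by rewrite trmx_mul trmxK -!mulrzA mulrC.
Qed.

Lemma left_annihilator_tr A : w A^T = w A.
Proof.
have := left_annihilator_act_trmx (fun B => (B == A)%:R).
rewrite mxcomb_act_indicator => <-; rewrite -(mxcomb_act_indicator w A^T).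
rewrite !mxcomb_actE; apply: eq_bigr => B _.
by rewrite mulmx1 /= (can2_eq (@trmxK _ _ _) (@trmxK _ _ _)).
Qed.

Lemma left_annihilator_minor (V : zmodType) m k (P : 'M_(m, n))
    (f : 'M[F]_(m, k) -> V) :
  ~~ row_full P -> mxcomb_act w (minor P f) = 0.
Proof.
rewrite -row_free_tr => P_dep; apply/funext => X.
rewrite -[RHS](w_annihil (fun Z => f (Z^T *m X)) P_dep) !mxcomb_actE.
rewrite (reindex_inj (@trmx_inj _ _ _)) /=; apply: eq_bigr => A _.
by rewrite left_annihilator_tr trmx_mul trmxK /minor mulmxA.
Qed.

End Annihilator.

Section KovacsStep.
Variables (F : finFieldType) (n : nat) (w : mxcomb F n).

Definition shear (t : 'M[F]_n * 'rV[F]_n * 'cV[F]_n) : 'M[F]_(1 + n) :=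
  let: (A, b, u) := t in col_mx b 1%:M *m row_mx u (A - u *m b).

Definition lift_mxcomb : mxcomb F (1 + n) := formal_sum (@lift0_mx F n) w.

Definition shear_mxcomb : mxcomb F (1 + n) :=
  formal_sum shear (fun t => w t.1.1).

Definition kovacs_step : mxcomb F (1 + n) :=
  mul_mxcomb lift_mxcomb
    (scalar_mxcomb (w 1%:M * (#|F| ^ n)%:Z) - shear_mxcomb).

Lemma shear_mul k A b u (y : 'rV_k) (x : 'M_(n, k)) :
  shear (A, b, u) *m col_mx y x =
  col_mx b 1%:M *m (A *m x + u *m (y - b *m x)).
Proof.
rewrite -mulmxA mul_row_col mulmxBl mulmxBr !mulmxA.
by rewrite [in RHS]addrCA.
Qed.

Lemma shear_singular t : shear t \notin unitmx.
Proof.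
case: t => [[A b] u]; rewrite -row_free_unit -row_leq_rank -ltnNge ltnS.
exact: leq_trans (mxrankM_maxr _ _) (rank_leq_row _).
Qed.

Lemma lift_mxcomb_scalar c :
  scalar_mod_singular w c -> scalar_mod_singular lift_mxcomb c.
Proof.
move=> wc C C_unit; rewrite /lift_mxcomb /formal_sum /scalar_mxcomb.
have [->|C_neq1] := eqVneq C 1%:M.
  under eq_bigl => A do rewrite lift0_mx_eq1.
  by rewrite big_pred1_eq (scalar_mod_singular1 wc).
rewrite big1 // => A /eqP AC; move: C_unit C_neq1.
rewrite -AC lift0_mx_eq1 -row_free_unit row_free_lift0_mx row_free_unit.
by move=> /wc -> /negPf A_neq1; rewrite /scalar_mxcomb A_neq1.
Qed.

Lemma kovacs_step_scalar c : scalar_mod_singular w c ->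
  scalar_mod_singular kovacs_step (c * (c * (#|F| ^ n)%:Z)).
Proof.
move=> wc; apply: scalar_mod_singularM; first exact: lift_mxcomb_scalar.
rewrite (scalar_mod_singular1 wc) => C C_unit.
have shear0 : shear_mxcomb C = 0.
  by apply: big1 => t /eqP tC; case/negP: (shear_singular t); rewrite tC.
by rewrite -[RHS]subr0 -shear0.
Qed.

Hypothesis w_annihil : left_annihilator w.
Variable c : int.
Hypothesis w_scalar : scalar_mod_singular w c.

Section StepAction.
Variables (V : zmodType) (k : nat) (f : 'M[F]_(1 + n, k) -> V).
Let lift_f := mxcomb_act lift_mxcomb f.
Let lift_minor b := minor (col_mx b 1%:M : 'M_(1 + n, n)) lift_f.

Lemma kovacs_step_act y x :
  mxcomb_act kovacs_step f (col_mx y x) =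
  lift_f (col_mx y x) *~ (c * (#|F| ^ n)%:Z) -
  \sum_b \sum_u mxcomb_act w
     (fun Z : 'M_(n, k) => lift_minor b (Z + u *m (y - b *m x))) x.
Proof.
rewrite mul_mxcomb_act mxcomb_actBl scalar_mxcomb_act.
rewrite (scalar_mod_singular1 w_scalar).
rewrite addrfctE opprfctE intmulfctE; congr (_ - _).
rewrite /shear_mxcomb formal_sum_act.
under [RHS]eq_bigr => b _ do
  (under eq_bigr => u _ do rewrite mxcomb_actE; rewrite exchange_big /=).
rewrite [RHS]exchange_big pair_bigA pair_bigA; apply: eq_bigr => [[[A b] u] _].
by rewrite shear_mul.
Qed.

Lemma lift_act_col y x : ~~ row_free x -> lift_f (col_mx y x) = 0.
Proof.
move=> x_dep; rewrite -[RHS](w_annihil (fun Z => f (col_mx y Z)) x_dep).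
rewrite /lift_f /lift_mxcomb formal_sum_act mxcomb_actE.
by apply: eq_bigr => A _; rewrite mul_lift0_mx_col.
Qed.

Lemma lift_minor_vanishing b : vanishing (lift_minor b).
Proof.
by move=> x x_dep; rewrite /lift_minor /minor mul_col_mx mul1mx lift_act_col.
Qed.

Lemma kovacs_step_vanishing : vanishing (mxcomb_act kovacs_step f).
Proof.
move=> X; rewrite -[X]vsubmxK; move: (usubmx X) (dsubmx X) => y x X_dep.
rewrite kovacs_step_act.
have [x_free|x_dep] := boolP (row_free x); last first.
  rewrite lift_act_col // mul0rz big1 ?subrr // => b _.
  by apply: big1 => u _; exact: w_annihil.
have /submxP[a y_def] := nrow_free_col_mx_submx x_free X_dep.
pose term b := \sum_u mxcomb_act w
  (fun Z : 'M_(n, k) => lift_minor b (Z + u *m (y - b *m x))) x.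
have off_diag b : b != a -> term b = 0.
  move=> ba; rewrite /term y_def -mulmxBl; apply: left_annihilator_shift => //.
  by rewrite subr_eq0 eq_sym.
have diag : term a = lift_f (col_mx y x) *~ (c * (#|F| ^ n)%:Z).
  rewrite /term y_def subrr; under eq_bigr => u _.
    under eq_fun => Z do rewrite mulmx0 addr0.
    rewrite (mxcomb_act_vanishing w_scalar (@lift_minor_vanishing a)).
    rewrite intmulfctE; over.
  rewrite sumr_const card_mx muln1 /lift_minor /minor mul_col_mx mul1mx.
  by rewrite mulrzA -pmulrn.
by rewrite (bigD1 a) //= [X in _ - (_ + X)]big1 // -/(term a) diag addr0 subrr.
Qed.

End StepAction.

Lemma kovacs_step_annihilator : left_annihilator kovacs_step.
Proof. exact: kovacs_step_vanishing. Qed.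

End KovacsStep.

Section KovacsElement.
Variable F : finFieldType.

Fixpoint kovacs_element n : mxcomb F n :=
  if n is n'.+1 then kovacs_step (@kovacs_element n') else scalar_mxcomb 1.

Arguments kovacs_element : clear implicits.

Definition kovacs_coef n : nat := #|F| ^ (2 ^ n - n.+1).

Lemma kovacs_coefS n :
  kovacs_coef n.+1 = (kovacs_coef n * (kovacs_coef n * #|F| ^ n))%N.
Proof.
rewrite /kovacs_coef -!expnD expnS; congr (_ ^ _)%N.
by have := ltn_expl n (ltnSn 1); lia.
Qed.

Lemma kovacs_element_scalar n :
  scalar_mod_singular (kovacs_element n) (kovacs_coef n)%:Z.
Proof.
elim: n => [|n IH]; first by [].
by rewrite kovacs_coefS !PoszM; exact: kovacs_step_scalar.
Qed.

Lemma kovacs_element_annihilator n : left_annihilator (kovacs_element n).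
Proof.
elim: n => [|n IH]; first by move=> V k f X; rewrite -row_leq_rank.
exact: (kovacs_step_annihilator IH (@kovacs_element_scalar n)).
Qed.

Section KovacsAct.
Variables (V : zmodType) (k : nat).

Definition kovacs_act n : ('M[F]_(n, k) -> V) -> 'M_(n, k) -> V :=
  mxcomb_act (kovacs_element n).

Lemma vanishing_kovacs_act n (f : 'M_(n, k) -> V) : vanishing (kovacs_act f).
Proof. exact: kovacs_element_annihilator. Qed.

Lemma kovacs_act_minor0 m n (P : 'M_(m, n)) (f : 'M_(m, k) -> V) :
  ~~ row_full P -> kovacs_act (minor P f) = 0.
Proof.
apply: left_annihilator_minor; first exact: kovacs_element_annihilator.
  exact: kovacs_element_scalar.
by rewrite eqz_nat -lt0n expn_gt0 (ltnW (card_finNzRing_gt1 F)).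
Qed.

Lemma kovacs_act_vanishing n (f : 'M_(n, k) -> V) :
  vanishing f -> kovacs_act f = f *+ kovacs_coef n.
Proof. exact: mxcomb_act_vanishing (@kovacs_element_scalar n). Qed.

Lemma kovacs_act0 n : kovacs_act (0 : 'M_(n, k) -> V) = 0.
Proof. by rewrite kovacs_act_vanishing // mul0rn. Qed.

Lemma mulrn_kovacs_coef n (f : 'M_(n, k) -> V) :
  f *+ kovacs_coef n = kovacs_act f -
    \sum_(A | A \notin unitmx) minor A f *~ kovacs_element n A.
Proof.
by rewrite /kovacs_act (mxcomb_act_singular f (@kovacs_element_scalar n)) addrK.
Qed.

Lemma kovacs_actD n (f g : 'M_(n, k) -> V) :
  kovacs_act (f + g) = kovacs_act f + kovacs_act g.
Proof. by rewrite -big_split; apply: eq_bigr => A _ /=; rewrite -mulrzDl. Qed.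

End KovacsAct.

Lemma kovacs_actZ (R : pzRingType) (V : lmodType R) n k a
    (f : 'M_(n, k) -> V) :
  kovacs_act (a *: f) = a *: kovacs_act f.
Proof. by rewrite scaler_sumr; apply: eq_bigr => A _; rewrite scalerMzr. Qed.

End KovacsElement.

Lemma invertibleX (R : pzRingType) (x : R) n :
  invertible x -> invertible (x ^+ n).
Proof.
case=> y [yx xy]; exists (y ^+ n).
by rewrite -!exprMn_comm /GRing.comm ?yx ?xy ?expr1n.
Qed.

Lemma scale_kovacs_coefK (F : finFieldType) (R : pzRingType) (V : lmodType R)
    n :
  invertible (#|F|%:R : R) ->
  exists y : R, forall x : V, y *: (x *+ kovacs_coef F n) = x.
Proof.
move=> card_inv; have [y [yq _]] : invertible ((kovacs_coef F n)%:R : R).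
  by rewrite natrX; exact: invertibleX.
by exists y => x; rewrite -scaler_nat scalerA yq scale1r.
Qed.

Section OperationFamilies.
Variables (F : finFieldType) (k : nat) (R : pzRingType) (B : lmodType R).

(* A clonoid in which arity zero is allowed. *)
Record opfamily := OpFamily {
  opfamily_set :> forall i, ('M[F]_(i, k) -> B) -> Prop;
  opfamily0 : forall i, opfamily_set (0 : 'M_(i, k) -> B);
  opfamilyD : forall i (f g : 'M_(i, k) -> B),
    opfamily_set f -> opfamily_set g -> opfamily_set (f + g);
  opfamilyZ : forall i a (f : 'M_(i, k) -> B),
    opfamily_set f -> opfamily_set (a *: f);
  opfamily_minor : forall i l (M : 'M_(i, l)) (f : 'M_(i, k) -> B),
    opfamily_set f -> opfamily_set (minor M f)
}.

Section Closure.
Variable K : opfamily.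

Lemma opfamily_sum (I : Type) (r : seq I) (P : pred I) i
    (f : I -> 'M_(i, k) -> B) :
  (forall t, P t -> K i (f t)) -> K i (\sum_(t <- r | P t) f t).
Proof.
by move=> Kf; apply: big_ind Kf; [exact: opfamily0|exact: opfamilyD].
Qed.

Lemma opfamilyMz i (f : 'M_(i, k) -> B) c : K i f -> K i (f *~ c).
Proof. by rewrite -scaler_int; exact: opfamilyZ. Qed.

Lemma opfamily_kovacs_act i (f : 'M_(i, k) -> B) : K i f -> K i (kovacs_act f).
Proof.
move=> Kf; apply: opfamily_sum => A _.
exact/opfamilyMz/opfamily_minor.
Qed.

Lemma opfamily_kovacs_ind m (f : 'M_(m, k) -> B) :
  invertible (#|F|%:R : R) ->
  (forall i (M : 'M_(m, i)), K i (kovacs_act (minor M f))) -> K m f.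
Proof.
move=> card_inv Kf; suff Kminor i (M : 'M_(m, i)) : K i (minor M f).
  by rewrite -[f]minor1.
elim/ltn_ind: i M => i IH M.
have [y yK] := scale_kovacs_coefK ('M[F]_(i, k) -> B : lmodType R) i card_inv.
rewrite -[minor M f]yK mulrn_kovacs_coef; apply/opfamilyZ/opfamilyD => //.
rewrite -scaleN1r; apply/opfamilyZ/opfamily_sum => A.
rewrite -row_free_unit -row_leq_rank -ltnNge => A_sing; apply: opfamilyMz.
rewrite -[A]mulmx_base -minorM mulmxA minorM.
by apply: opfamily_minor; exact: IH.
Qed.

Program Definition clonoid_of_family : clonoid F k B :=
  @Clonoid F k R B (fun m f => K m.+1 f) _ _ _.
Next Obligation. by exists 0%N, 0; exact: opfamily0. Qed.
Next Obligation.
move=> m n f g Kf [s gs] /=.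
have -> : (fun X => g (fun i => f i X)) = \sum_i s i *: f i.
  by apply/funext => X; rewrite gs fct_sumE.
by apply: opfamily_sum => i _; apply: opfamilyZ.
Qed.
Next Obligation.
move=> m n f g Kf g_term /=; have [s gs] := choice g_term.
have := opfamily_minor (\matrix_(i, l) s i l) Kf; congr (opfamily_set K _).
apply/funext => X; congr f; apply/row_matrixP => i.
rewrite rowK gs row_mul mulmx_sum_row; apply: eq_bigr => l _.
by rewrite !mxE.
Qed.

End Closure.

Section FamilyOfClonoid.
Variable C : clonoid F k B.

Lemma clonoid_minor m n (M : 'M_(m.+1, n.+1)) (f : 'M[F]_(m.+1, k) -> B) :
  C m f -> C n (minor M f).
Proof.
move=> Cf; pose g i (x : 'I_n.+1 -> 'rV[F]_k) := \sum_l M i l *: x l.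
have g_term i : term_op (g i) by exists (M i).
have := clonoid_dom C m n f g Cf g_term; congr (C n _).
apply/funext => X; congr f; apply/row_matrixP => i.
by rewrite rowK row_mul mulmx_sum_row; apply: eq_bigr => l _; rewrite mxE.
Qed.

Lemma clonoidZ m a (f : 'M[F]_(m.+1, k) -> B) : C m f -> C m (a *: f).
Proof.
move=> Cf; apply: (clonoid_codom C m 0 (fun=> f) (fun x => a *: x ord0)) => //.
by exists (fun=> a) => x; rewrite big_ord1.
Qed.

Lemma clonoidD m (f g : 'M[F]_(m.+1, k) -> B) : C m f -> C m g -> C m (f + g).
Proof.
move=> Cf Cg; pose fg (i : 'I_2) := if i == ord0 then f else g.
apply: (clonoid_codom C m 1 fg (fun x => x ord0 + x (lift ord0 ord0))).
  by move=> i; rewrite /fg; case: (i == ord0).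
by exists (fun=> 1) => x; rewrite big_ord_recl big_ord1 !scale1r.
Qed.

Program Definition family_of_clonoid : opfamily :=
  @OpFamily (fun i f => forall n (M : 'M_(i, n.+1)), C n (minor M f)) _ _ _ _.
Next Obligation. by move=> i n M; exact: clonoid0. Qed.
Next Obligation.
by move=> i f g Cf Cg n M; rewrite minorD; exact: clonoidD.
Qed.
Next Obligation. by move=> i a f Cf n M; rewrite minorZ; exact: clonoidZ. Qed.
Next Obligation. by move=> i l M f Cf n P /=; rewrite -minorM. Qed.

Lemma family_of_clonoidS m (f : 'M_(m.+1, k) -> B) :
  family_of_clonoid m.+1 f <-> C m f.
Proof.
split=> [Cf|Cf n M]; last exact: clonoid_minor.
by rewrite -[f]minor1; exact: Cf.
Qed.

End FamilyOfClonoid.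

Lemma clonoid_of_familyK (K : opfamily) i (f : 'M_(i, k) -> B) :
  family_of_clonoid (clonoid_of_family K) i f <-> K i f.
Proof.
split=> [Kf|Kf n M]; last exact: opfamily_minor.
pose proj : 'M[F]_(i, 1 + i) := row_mx 0 1%:M.
have proj_inv : proj *m col_mx 0 1%:M = 1%:M.
  by rewrite mul_row_col mulmx0 add0r mul1mx.
rewrite -[f]minor1 -proj_inv minorM; apply: opfamily_minor.
exact: Kf.
Qed.

End OperationFamilies.

Lemma submoduleD (M : actModule) (U : submodule M) x y :
  U x -> U y -> U (x + y).
Proof.
move=> Ux Uy; rewrite -[y]opprK -[- y]sub0r; apply: submoduleB => //.
by apply: submoduleB => //; exact: submodule0.
Qed.

Section FullRank.
Variables (F : finFieldType) (k : nat) (R : pzRingType) (B : lmodType R).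

Definition full_restr i : ('M[F]_(i, k) -> B) -> Mmod F k B i :=
  match i return ('M[F]_(i, k) -> B) -> Mmod F k B i with
  | 0 => fun f => f 0
  | i'.+1 => fun f X => f (sval X)
  end.

Definition zero_ext i : Mmod F k B i -> 'M[F]_(i, k) -> B :=
  match i return Mmod F k B i -> 'M[F]_(i, k) -> B with
  | 0 => fun b _ => b
  | i'.+1 => fun u X =>
      if insub X is Some Y
      then u (Y : {X : 'M[F]_(i'.+1, k) | \rank X == i'.+1}) else 0
  end.

Lemma zero_ext_vanishing i (u : Mmod F k B i) : vanishing (zero_ext u).
Proof.
case: i u => [|i] u X; first by rewrite -row_leq_rank.
by move=> X_dep /=; rewrite insubF //; exact: negPf.
Qed.

Lemma zero_ext_sval i (u : Mmod F k B i.+1) (X : full_rank F k i.+1) :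
  zero_ext u (sval X) = u X.
Proof. by rewrite /= valK. Qed.

Lemma zero_extK i : cancel (@zero_ext i) (@full_restr i).
Proof. by case: i => [|i] u //; apply/funext => X; exact: zero_ext_sval. Qed.

Lemma full_restrK i (f : 'M[F]_(i, k) -> B) :
  vanishing f -> zero_ext (full_restr f) = f.
Proof.
case: i f => [|i] f f0; apply/funext => X /=; first by rewrite (flatmx0 X).
by case: insubP => [Y _ <- //|X_dep]; rewrite f0.
Qed.

Lemma zero_ext0 i : zero_ext (0 : Mmod F k B i) = 0.
Proof. by case: i => [|i] //; apply/funext => X /=; case: insub. Qed.

Lemma zero_extB i (u v : Mmod F k B i) :
  zero_ext (u - v) = zero_ext u - zero_ext v.
Proof.
case: i u v => [|i] u v //; apply/funext => X; rewrite addrfctE opprfctE /=.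
by case: insub => [Y|] //; rewrite subr0.
Qed.

Lemma zero_ext_group_ring_act i a (u : Mmod F k B i.+1) :
  zero_ext (group_ring_act a u : Mmod F k B i.+1) =
  \sum_(M : {'GL_i.+1[F]}) a M *: minor (GLval M : 'M_i.+1) (zero_ext u).
Proof.
apply/funext => X; rewrite fct_sumE; have [X_free|X_dep] := boolP (row_free X).
  rewrite -[X]/(sval (exist _ X X_free : full_rank F k i.+1)) zero_ext_sval.
  by apply: eq_bigr => M _; rewrite -(zero_ext_sval u (GLmul M _)).
rewrite zero_ext_vanishing // big1 // => M _; rewrite scalrfctE /minor.
rewrite zero_ext_vanishing ?scaler0 //.
by apply: contra X_dep; exact: row_free_mulmxr.
Qed.

Section Submodule.
Variables (i : nat) (U : submodule (Mmod F k B i)).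

Lemma submodule_full_restr0 : U (full_restr 0).
Proof. by have := submodule0 U; congr (submodule_set U _); case: (i). Qed.

Lemma submodule_full_restrD f g :
  U (full_restr f) -> U (full_restr g) -> U (full_restr (f + g)).
Proof.
move=> Uf Ug; have := submoduleD Uf Ug; congr (submodule_set U _).
by case: (i) f g {Uf Ug}.
Qed.

Lemma submodule_full_restrZ_minor a (M : 'M[F]_i) f :
  M \in unitmx -> U (full_restr f) -> U (full_restr (a *: minor M f)).
Proof.
case: i U M f => [|j] W M f M_unit /=.
  rewrite scalrfctE /minor mulmx0.
  exact: (@submodule_act _ W (a : am_scalar (Mmod F k B 0))).
pose G := Sub M M_unit : {'GL_j.+1[F]}.
pose a_G : {ffun {'GL_j.+1[F]} -> R} := [ffun N => if N == G then a else 0].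
move/(@submodule_act _ W (a_G : am_scalar (Mmod F k B j.+1))).
congr (submodule_set W _); apply/funext => X.
rewrite /= /group_ring_act (bigD1 G) //= ffunE eqxx big1 ?addr0 // => N.
by rewrite ffunE => /negPf ->; rewrite scale0r.
Qed.

Lemma submodule_full_restrZ a f : U (full_restr f) -> U (full_restr (a *: f)).
Proof.
move=> /(submodule_full_restrZ_minor a (unitmx1 _ _)).
by rewrite minor1.
Qed.

End Submodule.
End FullRank.

Section Correspondence.
Variables (F : finFieldType) (k : nat) (R : pzRingType) (B : lmodType R).

Program Definition full_part (K : opfamily F k B) i :
    submodule (Mmod F k B i) :=
  @Submodule _ (fun u => K i (zero_ext u)) _ _ _.
Next Obligation. by move=> K i /=; rewrite zero_ext0; exact: opfamily0. Qed.
Next Obligation.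
move=> K i u v Ku Kv /=; rewrite zero_extB; apply: opfamilyD => //.
by rewrite -scaleN1r; exact: opfamilyZ.
Qed.
Next Obligation.
move=> K [|i] a u Ku; first exact: (opfamilyZ a Ku).
have : K i.+1 (\sum_M a M *: minor (GLval M : 'M_i.+1) (zero_ext u)).
  by apply: opfamily_sum => M _; exact/opfamilyZ/opfamily_minor.
by rewrite -zero_ext_group_ring_act.
Qed.

Lemma full_part_full_restr (K : opfamily F k B) i (f : 'M_(i, k) -> B) :
  vanishing f -> full_part K i (full_restr f) <-> K i f.
Proof. by move=> f0; rewrite /= full_restrK. Qed.

Program Definition gen_family
    (U : forall i : 'I_k.+1, submodule (Mmod F k B i)) : opfamily F k B :=
  @OpFamily F k R B
    (fun m f => forall (i : 'I_k.+1) (M : 'M_(m, i)),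
       U i (full_restr (kovacs_act (minor M f)))) _ _ _ _.
Next Obligation.
move=> U m i M; rewrite [kovacs_act _]kovacs_act0.
exact: submodule_full_restr0.
Qed.
Next Obligation.
move=> U m f g Uf Ug i M.
by rewrite minorD kovacs_actD; exact: submodule_full_restrD.
Qed.
Next Obligation.
move=> U m a f Uf i M.
by rewrite minorZ kovacs_actZ; exact: submodule_full_restrZ.
Qed.
Next Obligation. by move=> U m l P f Uf i M; rewrite -minorM. Qed.

Section LowMinors.
Variables (j m : nat) (f : 'M[F]_(m, k) -> B).

(* [gen_by_minors j f] is [low_minor_span m f]. *)
Program Definition low_minor_span : opfamily F k B :=
  @OpFamily F k R B
    (fun i g => exists (p : nat) (M : 'I_p -> 'M_(m, i)) (a : 'I_p -> R),
       (forall t, (\rank (M t) <= j)%N) /\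
       (forall X, g X = \sum_(t < p) a t *: f (M t *m X))) _ _ _ _.
Next Obligation.
move=> i; exists 0%N, (fun=> 0), (fun=> 0).
by split=> [[]|X]; rewrite ?big_ord0.
Qed.
Next Obligation.
move=> i g h [p [M [a [rM gE]]]] [p' [M' [a' [rM' hE]]]].
pose join T (c : 'I_p -> T) (c' : 'I_p' -> T) t :=
  match fintype.split t with inl s => c s | inr s => c' s end.
exists (p + p')%N, (join _ M M'), (join _ a a'); split=> [t|X].
  by rewrite /join; case: fintype.split.
rewrite big_split_ord addrfctE gE hE /join.
congr (_ + _); apply: eq_bigr => t _.
  by rewrite (unsplitK (inl t)).
by rewrite (unsplitK (inr t)).
Qed.
Next Obligation.
move=> i c g [p [M [a [rM gE]]]]; exists p, M, (fun t => c * a t); split=> // X.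
rewrite scalrfctE gE scaler_sumr; apply: eq_bigr => t _.
by rewrite scalerA.
Qed.
Next Obligation.
move=> i l P g [p [M [a [rM gE]]]]; exists p, (fun t => M t *m P), a.
split=> [t|X].
  exact: leq_trans (mxrankM_maxl _ _) (rM t).
by rewrite /minor gE; apply: eq_bigr => t _; rewrite mulmxA.
Qed.

Lemma low_minor_span_minor i (M : 'M_(m, i)) :
  (\rank M <= j)%N -> low_minor_span i (minor M f).
Proof.
move=> rM; exists 1%N, (fun=> M), (fun=> 1); split=> // X.
by rewrite big_ord1 scale1r.
Qed.

End LowMinors.

Lemma vanishing_low_minor_span j i (f : 'M[F]_(i, k) -> B) :
  (j < i)%N -> vanishing f -> gen_by_minors j f -> f = 0.
Proof.
move=> ji f0 [p [M [a [rM fE]]]]; apply/funext => X.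
rewrite fE big1 // => t _; rewrite f0 ?scaler0 //.
rewrite -row_leq_rank -ltnNge.
exact: leq_ltn_trans (mxrankM_maxl _ _) (leq_ltn_trans (rM t) ji).
Qed.

Hypothesis card_inv : invertible (#|F|%:R : R).

Lemma full_part_gen_family (U : forall i : 'I_k.+1, submodule (Mmod F k B i))
    (i : 'I_k.+1) :
  full_part (gen_family U) i = U i.
Proof.
apply: submodule_eq => u; split=> [Uu|Uu].
  have [y yK] := scale_kovacs_coefK ('M[F]_(i, k) -> B : lmodType R) i card_inv.
  have := submodule_full_restrZ y (Uu i 1%:M).
  by rewrite minor1 (kovacs_act_vanishing (zero_ext_vanishing u)) yK zero_extK.
move=> j P; have u0 := zero_ext_vanishing u.
have [P_full|P_nfull] := boolP (row_full P); last first.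
  by rewrite kovacs_act_minor0 //; exact: submodule_full_restr0.
have [P_free|P_dep] := boolP (row_free P); last first.
  rewrite (vanishing_minor u0 P_dep) [kovacs_act _]kovacs_act0.
  exact: submodule_full_restr0.
have ij : i = j.
  apply/val_inj/eqP; rewrite eqn_leq (row_free_leq P_free) /=.
  by move: P_full; rewrite -row_free_tr => /row_free_leq.
case: _ / ij P P_full {P_free} => P; rewrite row_full_unit => P_unit.
have Pu0 : vanishing (minor P (zero_ext u)).
  by move=> X X_dep; apply: u0; apply: contra X_dep; exact: row_free_mulmxr.
rewrite [kovacs_act _]kovacs_act_vanishing // -scaler_nat.
by apply: submodule_full_restrZ_minor => //; rewrite zero_extK.
Qed.

Lemma gen_family_full_part (K : opfamily F k B) m (f : 'M_(m, k) -> B) :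
  gen_family (full_part K) m f <-> K m f.
Proof.
split=> [Kf|Kf i M]; last first.
  apply/full_part_full_restr; first exact: vanishing_kovacs_act.
  exact/opfamily_kovacs_act/opfamily_minor.
apply: opfamily_kovacs_ind => // i M.
have act0 := vanishing_kovacs_act (minor M f).
have [ik|ki] := ltnP i k.+1.
  by apply/full_part_full_restr; [|exact: (Kf (Ordinal ik))].
by rewrite (vanishing_wide ki act0); exact: opfamily0.
Qed.

Lemma full_part_eq0P (K : opfamily F k B) j :
  (forall i : 'I_k.+1, (j < i)%N -> is_zero_submodule (full_part K i)) <->
  (forall m (f : 'M[F]_(m.+1, k) -> B), K m.+1 f -> gen_by_minors j f).
Proof.
split=> [K_high0 m f Kf|K_low [[|i] lti] // ji u]; last first.
  split=> [/K_low u_low|->]; last exact: submodule0.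
  rewrite -[u]zero_extK (vanishing_low_minor_span ji _ u_low) //.
  exact: zero_ext_vanishing.
suff: low_minor_span j f m.+1 f by [].
apply: opfamily_kovacs_ind => // i M.
have [ij|ji] := leqP i j.
  apply/opfamily_kovacs_act/low_minor_span_minor.
  exact: leq_trans (rank_leq_col _) ij.
suff -> : kovacs_act (minor M f) = 0 by exact: opfamily0.
have act0 := vanishing_kovacs_act (minor M f).
have [ik|ki] := ltnP i k.+1; last exact: vanishing_wide.
rewrite -[LHS]full_restrK // -zero_ext0; congr zero_ext.
apply/(K_high0 (Ordinal ik) ji)/full_part_full_restr => //.
exact/opfamily_kovacs_act/opfamily_minor.
Qed.

End Correspondence.

Section OrderIso.
Variables (d d' : Order.disp_t) (L : latticeType d) (L' : latticeType d').
Variables (phi : L -> L') (psi : L' -> L).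
Hypothesis psiK : cancel psi phi.
Hypothesis phi_le : {mono phi : x y / (x <= y)%O}.

Lemma order_iso_meet : {morph phi : x y / (x `&` y)%O}.
Proof.
move=> x y; apply/le_anti; rewrite lexI !phi_le leIl leIr /=.
by rewrite -[X in (X <= _)%O]psiK phi_le lexI -!phi_le !psiK leIl leIr.
Qed.

Lemma order_iso_join : {morph phi : x y / (x `|` y)%O}.
Proof.
move=> x y; apply/le_anti; rewrite leUx !phi_le leUl leUr andbT.
by rewrite -[X in (_ <= X)%O]psiK phi_le leUx -!phi_le !psiK leUl leUr.
Qed.

End OrderIso.

Section ClonoidIso.
Variables (F : finFieldType) (k : nat) (R : pzRingType) (B : lmodType R).

Local Notation part_lattice := (prod_lattice (fun i : 'I_k.+1 => Msub F k B i)).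

Definition clonoid_parts (C : clonoid F k B) : part_lattice :=
  fun i => full_part (family_of_clonoid C) i.

Definition clonoid_of_parts (U : part_lattice) : clonoid F k B :=
  clonoid_of_family (gen_family U).

Lemma clonoid_parts_le C D :
  (C <= D)%O -> (clonoid_parts C <= clonoid_parts D)%O.
Proof.
move=> /clonoid_leP CD; apply/prod_leP => i; apply/submodule_leP => u Cu n M.
exact/CD/Cu.
Qed.

Lemma clonoid_of_parts_le U V :
  (U <= V)%O -> (clonoid_of_parts U <= clonoid_of_parts V)%O.
Proof.
move=> /prod_leP UV; apply/clonoid_leP => m f Uf i M.
by have /submodule_leP := UV i; apply; exact: Uf.
Qed.

Hypothesis card_inv : invertible (#|F|%:R : R).

Lemma clonoid_partsK : cancel clonoid_parts clonoid_of_parts.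
Proof.
move=> C; apply: clonoid_eq => m f.
exact: iff_trans (gen_family_full_part card_inv _ _) (family_of_clonoidS _ _).
Qed.

Lemma clonoid_of_partsK : cancel clonoid_of_parts clonoid_parts.
Proof.
move=> U; apply: functional_extensionality_dep => i.
rewrite -[RHS](full_part_gen_family card_inv); apply: submodule_eq => u.
exact: clonoid_of_familyK.
Qed.

Lemma le_clonoid_parts : {mono clonoid_parts : C D / (C <= D)%O}.
Proof.
move=> C D; apply/idP/idP; last exact: clonoid_parts_le.
by move/clonoid_of_parts_le; rewrite !clonoid_partsK.
Qed.

Lemma clonoid_parts_eq0P C j :
  (forall i : 'I_k.+1, (j < i)%N -> is_zero_submodule (clonoid_parts C i)) <->
  (forall m (f : 'M[F]_(m.+1, k) -> B), C m f -> gen_by_minors j f).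
Proof.
apply: iff_trans (full_part_eq0P card_inv (family_of_clonoid C) j) _.
by split=> low m f /family_of_clonoidS; exact: low.
Qed.

End ClonoidIso.

Theorem theorem55 (F : finFieldType) (k : nat) (R : pzRingType)
    (B : lmodType R) (hk : (0 < k)%N) (hF : invertible (#|F|%:R : R)) :
  exists phi : clonoid F k B -> prod_lattice (fun i : 'I_k.+1 => Msub F k B i),
    [/\ bijective phi,
        {morph phi : C D / (C `&` D)%O},
        {morph phi : C D / (C `|` D)%O} &
        forall (j : nat), (j <= k)%N -> forall C : clonoid F k B,
          (forall i : 'I_k.+1, (j < i)%N -> is_zero_submodule (phi C i)) <->
          (forall (m : nat) (f : 'M[F]_(m.+1, k) -> B),
             C m f -> gen_by_minors j f)].
Proof.
exists (@clonoid_parts F k R B); split.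
- exists (@clonoid_of_parts F k R B); first exact: clonoid_partsK.
  exact: clonoid_of_partsK.
- exact: order_iso_meet (clonoid_of_partsK hF) (le_clonoid_parts hF).
- exact: order_iso_join (clonoid_of_partsK hF) (le_clonoid_parts hF).
- by move=> j _ C; exact: clonoid_parts_eq0P.
Qed.
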